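(* For every even integer $n\ge 2$, the group $F_n\times\mathbb{Z}$ has a positive cone which is finitely generated as a semigroup.
   Context: $F_n$ denotes the free group of rank $n$. A positive cone of a group $G$ is a subsemigroup $P\subseteq G$ (a subset closed under multiplication) such that $G=P\sqcup P^{-1}\sqcup\{1\}$ (disjoint union), where $P^{-1}=\{p^{-1}:p\in P\}$. For $S\subseteq G$, $\langle S\rangle^+$ denotes the semigroup of all non-empty products $s_1\cdots s_\ell$ with $s_i\in S$ and $\ell\ge 1$. A positive cone $P$ is finitely generated (as a semigroup) if $P=\langle S\rangle^+$ for some finite set $S$. *)

(* Defs.v *)
From HB Require Import structures.
From mathcomp Require Import all_boot all_order all_algebra.
From mathcomp Require Import boolp classical_sets functions cardinality.

Set Implicit Arguments.
Unset Strict Implicit.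
Unset Printing Implicit Defensive.

Local Open Scope classical_set_scope.
Local Open Scope group_scope.

(* The free group on an alphabet T, as the set of reduced words in the letters
   x^{+1} = (x, true) and x^{-1} = (x, false); the product is concatenation
   followed by free reduction. *)
Section FreeGroup.
Variable T : choiceType.
Local Notation letter := (T * bool)%type.
Implicit Types (a b : letter) (u v w : seq letter).

Definition invl a : letter := (a.1, ~~ a.2).

Definition reduced w := sorted (fun a b => b != invl a) w.

Definition cons_red a w :=
  if w is b :: w' then if b == invl a then w' else a :: w else [:: a].

Definition mulw u v := foldr cons_red v u.

Definition invw u := rev (map invl u).

Lemma invlK : involutive invl.
Proof. by case=> x b; rewrite /invl /= negbK. Qed.

Lemma cons_red_reduced a w : reduced w -> reduced (cons_red a w).
Proof.
case: w => [//|b w] /= bw; case: eqP => [_|/eqP nba].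
  exact: path_sorted bw.
by rewrite /reduced /= nba.
Qed.

Lemma cons_redE a w : reduced (a :: w) -> cons_red a w = a :: w.
Proof. by case: w => [//|b w] /= /andP[/negPf->]. Qed.

Lemma cons_redKV a w : reduced w -> cons_red a (cons_red (invl a) w) = w.
Proof.
case: w => [|b w] bw /=; first by rewrite eqxx.
rewrite invlK; case: eqP => [ba|_] /=; last by rewrite eqxx.
by subst b; exact: cons_redE.
Qed.

Lemma cons_redK a w : reduced w -> cons_red (invl a) (cons_red a w) = w.
Proof. by move=> rw; rewrite -{2}[a]invlK cons_redKV. Qed.

Lemma mulw_reduced u v : reduced v -> reduced (mulw u v).
Proof. by move=> rv; elim: u => //= a u; exact: cons_red_reduced. Qed.

Lemma mulw0 u : reduced u -> mulw u [::] = u.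
Proof.
elim: u => //= a u IHu au; rewrite /= IHu ?cons_redE //.
exact: path_sorted au.
Qed.

Lemma mulw_cons_red a v w : reduced w ->
  mulw (cons_red a v) w = cons_red a (mulw v w).
Proof.
move=> rw; case: v => [//|b v] /=; case: eqP => [->|_] //=.
by rewrite cons_redKV //; exact: mulw_reduced.
Qed.

Lemma mulwA u v w : reduced w -> mulw u (mulw v w) = mulw (mulw u v) w.
Proof. by move=> rw; elim: u => //= a u ->; rewrite mulw_cons_red. Qed.

Lemma mulVw_cancel u w : reduced w -> mulw (invw u) (mulw u w) = w.
Proof.
move=> rw; elim: u => //= a u IHu; rewrite /invw /= rev_cons /mulw foldr_rcons.
by rewrite cons_redK //; exact: mulw_reduced.
Qed.

Lemma invwK : involutive invw.
Proof. by move=> u; rewrite /invw map_rev revK mapK //; exact: invlK. Qed.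

Lemma invw_reduced u : reduced u -> reduced (invw u).
Proof.
rewrite /reduced /invw rev_sorted sorted_map; apply: sub_sorted => a b /=.
by apply: contra => /eqP->; rewrite invlK.
Qed.

Definition free_group := {w : seq letter | reduced w}.

HB.instance Definition _ := Choice.on free_group.

Implicit Types x y z : free_group.

Definition fg_one : free_group := exist _ [::] isT.
Definition fg_mul x y : free_group :=
  exist _ (mulw (val x) (val y)) (mulw_reduced (val x) (valP y)).
Definition fg_inv x : free_group :=
  exist _ (invw (val x)) (invw_reduced (valP x)).

Fact fg_mulA : associative fg_mul.
Proof. by move=> x y z; apply: val_inj; exact: mulwA (valP z). Qed.
Fact fg_mul1 : left_id fg_one fg_mul.
Proof. by move=> x; exact: val_inj. Qed.
Fact fg_mulr1 : right_id fg_one fg_mul.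
Proof. by move=> x; apply: val_inj; exact: mulw0 (valP x). Qed.
Fact fg_mulV : left_inverse fg_one fg_inv fg_mul.
Proof.
move=> x; apply: val_inj => /=.
by rewrite -{2}[val x](mulw0 (valP x)) mulVw_cancel.
Qed.
Fact fg_mulrV : right_inverse fg_one fg_inv fg_mul.
Proof.
move=> x; rewrite -{1}(_ : fg_inv (fg_inv x) = x) ?fg_mulV //.
by apply: val_inj => /=; rewrite invwK.
Qed.

HB.instance Definition _ :=
  isGroup.Build free_group fg_mulA fg_mul1 fg_mulr1 fg_mulV fg_mulrV.

Definition fg_gen (t : T) : free_group := exist _ [:: (t, true)] isT.

End FreeGroup.

Section UniversalProperty.
Variables (T : choiceType) (G : groupType) (f : T -> G).

Definition evall (a : T * bool) : G := if a.2 then f a.1 else (f a.1)^-1.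
Definition fg_lift (x : free_group T) : G := \prod_(a <- val x) evall a.

Lemma evall_invl a : evall (invl a) = (evall a)^-1.
Proof. by case: a => t []; rewrite /evall //= invgK. Qed.

Lemma fg_lift_gen t : fg_lift (fg_gen t) = f t.
Proof. by rewrite /fg_lift /= big_seq1. Qed.

Lemma fg_liftM : {morph fg_lift : x y / x * y}.
Proof.
move=> x y; rewrite /fg_lift /= /mulw.
elim: (val x) => [|a u IHu] /=; first by rewrite big_nil mul1g.
rewrite big_cons -mulgA -IHu; case: (foldr _ _ u) => [|b w] /=.
  by rewrite big_seq1 big_nil mulg1.
case: eqP => [->|_]; rewrite !big_cons // evall_invl mulgA mulgV mul1g //.
Qed.

Lemma fg_lift_unique (h : free_group T -> G) :
    {morph h : x y / x * y} -> (forall t, h (fg_gen t) = f t) ->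
  h =1 fg_lift.
Proof.
move=> hM hf.
have h1 : h 1 = 1 by apply: (@mulgI _ (h 1)); rewrite -hM !mulg1.
have hV x : h x^-1 = (h x)^-1.
  by apply: (@mulgI _ (h x)); rewrite -hM !mulgV.
case=> w rw; rewrite /fg_lift /=; elim: w rw => [|a w IHw] rw.
  rewrite big_nil -h1; congr h; exact: val_inj.
have rw' : reduced w by exact: path_sorted rw.
rewrite big_cons -(IHw rw').
pose l : free_group T := exist _ [:: a] isT.
have -> : exist _ (a :: w) rw = l * exist _ w rw' :> free_group T.
  by apply: val_inj; rewrite /= cons_redE.
rewrite hM; congr (_ * _); rewrite /evall -hf -hV.
by case: ifP => ea; congr h; apply: val_inj => /=;
  case: (a) ea => t b /= ->.
Qed.

End UniversalProperty.

Section PositiveCones.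
Variable G : groupType.
Implicit Types P S : set G.

Definition inv_set P : set G := [set p^-1 | p in P].

Definition positive_cone P : Prop :=
  [/\ forall x y, P x -> P y -> P (x * y),
      P `|` inv_set P `|` [set 1] = [set: G],
      P `&` inv_set P = set0,
      P `&` [set 1] = set0 &
      inv_set P `&` [set 1] = set0].

Definition semigroup_gen S : set G :=
  [set x | exists s : seq G,
    [/\ s <> [::], forall y, y \in s -> S y & x = \prod_(y <- s) y]].

Definition fin_gen_semigroup P : Prop :=
  exists S : set G, finite_set S /\ P = semigroup_gen S.

End PositiveCones.

(* Main.v *)
Require Import Defs.
From HB Require Import structures.
From mathcomp Require Import all_boot all_order all_algebra.
From mathcomp Require Import zify ring.
From mathcomp Require Import boolp classical_sets functions cardinality.

Set Implicit Arguments.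
Unset Strict Implicit.
Unset Printing Implicit Defensive.

Local Open Scope classical_set_scope.
Local Open Scope group_scope.

(** Write n = p + 1, N = 2 n and m = N - 1.  List the N letters of the free
    group F_n cyclically as c_0, ..., c_(N-1), with c_(i+n) the inverse of c_i;
    this is the cyclic order of the sides of a 2n-gon whose opposite sides are
    glued.  Let G be the semidirect product of F_n by Z = <a>, where a sends
    c_i to c_(i+1).  Its subgroup of elements (w, N q) is F_n x Z, as a^N acts
    trivially.  With b = c_0 a^(1-n), G is generated by a and b, and

          b a^m b = a,   hence   b^-1 a = a^m b   and   a b^-1 = b a^m.

    The cone of G is P = <a, b>^+ (Navas's cone on a central extension of a
    Hecke group).  Each positive word can be rewritten, by b a^m b = a and by
    pushing the central a^N to the right, into a word a^e0 b a^e1 b ... b a^j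
    with e0 <= m and the other e's < m ([cone2_nword]).

    - P misses 1: the F_n-component of such a word has one letter for each b,
      and it is reduced because two successive letters cancel only if the
      exponent between them is m modulo N ([sp_nword_reduced]).
    - P and its inverse cover G minus 1: every x is a positive element times a
      power of a^-N ([sp_gen]), so x = a^e0 b a^e1 b ... b a^z with z an
      integer.  If z >= 0 then x is positive or 1; if z < 0, replacing each
      b^-1 by a^-1 b a^m in x^-1 leaves only non-negative exponents
      ([nword_inv_cone2]).

    So P meets F_n x Z in a positive cone.  For n even, 1 - n is a unit modulo
    N, hence G is the union of the translates H b^r, 0 <= r < N, of
    H = F_n x Z.  This makes the intersection of P and H finitely generated:
    cut a positive word of H before each a but the first, and insert b^-r b^r
    at the cut, with r < N chosen so that all pieces lie in H.  The pieces are
    b^i a b^k b^-r with r < N, and splitting off powers of b^N, which is in H,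
    leaves i, k < N ([cone2_meet_gens]); a word without a is b^r times such a
    power, with r < N and b^r in H.  The negative power is harmless, as
    a b^-1 = b a^m is positive. *)

(** * Generated semigroups and positive cones *)

Section GeneratedSemigroups.
Variable G : groupType.
Implicit Types (S P : set G) (x y : G).

Lemma semigroup_gen_mem S x : S x -> semigroup_gen S x.
Proof.
move=> Sx; exists [:: x]; split=> // [y|]; last by rewrite big_seq1.
by rewrite inE => /eqP->.
Qed.

Lemma semigroup_genM S x y :
  semigroup_gen S x -> semigroup_gen S y -> semigroup_gen S (x * y).
Proof.
move=> [s [s0 sS ->]] [t [t0 tS ->]]; exists (s ++ t); split.
- by case: s s0 {sS}.
- by move=> z; rewrite mem_cat => /orP[/sS|/tS].
- by rewrite big_cat.
Qed.

Lemma semigroup_gen_ind S (K : G -> Prop) :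
    (forall x, S x -> K x) ->
    (forall x y, S x -> semigroup_gen S y -> K y -> K (x * y)) ->
  forall x, semigroup_gen S x -> K x.
Proof.
move=> K1 KM x [s [s0 sS ->]]; elim: s s0 sS => // c [|d s] IHs _ sS.
  by rewrite big_seq1; apply: K1; apply: sS; rewrite inE.
have sS' y : y \in d :: s -> S y by move=> ys; apply: sS; rewrite inE ys orbT.
rewrite big_cons; apply: KM; [by apply: sS; rewrite inE eqxx| |exact: IHs].
by exists (d :: s).
Qed.

Lemma semigroup_gen_sub S P :
    (forall x y, P x -> P y -> P (x * y)) -> S `<=` P ->
  semigroup_gen S `<=` P.
Proof.
move=> PM SP x; apply: semigroup_gen_ind => [y /SP//|y z /SP Py _].
exact: PM.
Qed.

Lemma positive_coneI P :
    (forall x y, P x -> P y -> P (x * y)) -> ~ P 1 ->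
    (forall x, [\/ P x, P x^-1 | x = 1]) ->
  positive_cone P.
Proof.
move=> PM P1 Ptot; split=> //.
- apply/seteqP; split=> // x _; case: (Ptot x) => [Px|PVx|->]; last by right.
    by left; left.
  by left; right; exists x^-1; rewrite ?invgK.
- apply/seteqP; split=> // x [Px [y Py yx]]; apply: P1.
  by rewrite -(mulgV y) yx; apply: PM.
- by apply/seteqP; split=> // x [Px x1]; apply: P1; rewrite -x1.
- apply/seteqP; split=> // x [[y Py <-] /= y1]; apply: P1.
  by rewrite -invg1 -y1 invgK.
Qed.

End GeneratedSemigroups.

(** * Pulling a cone back along an embedding *)

Section Pullback.
Variables (L G : groupType) (f : L -> G).
Hypotheses (fM : {morph f : x y / x * y}) (f_inj : injective f).

Let f1 : f 1 = 1.
Proof. by apply: (mulgI (f 1)); rewrite -fM !mulg1. Qed.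

Let fV x : f x^-1 = (f x)^-1.
Proof. by apply: (mulgI (f x)); rewrite -fM !mulgV. Qed.

Lemma positive_cone_preimage (P : set G) :
    (forall x y, P x -> P y -> P (x * y)) -> ~ P 1 ->
    (forall x, [\/ P x, P x^-1 | x = 1]) ->
  positive_cone (f @^-1` P).
Proof.
move=> PM P1 Ptot; apply: positive_coneI => [x y Px Py| |x] /=.
- by rewrite fM; apply: PM.
- by rewrite f1.
- rewrite fV; case: (Ptot (f x)) => [Pfx|PVfx|fx1]; [exact: Or31|exact: Or32|].
  by apply: Or33; apply: f_inj; rewrite f1.
Qed.

(** Because [S] lies in the image of [f], each factor of a product of elements
    of [S] lifts, so that generation can be tested in [G]. *)
Lemma fin_gen_preimage (P S : set G) :
    finite_set S -> S `<=` range f -> P `&` range f = semigroup_gen S ->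
  fin_gen_semigroup (f @^-1` P).
Proof.
move=> finS Sf PS; exists (f @^-1` S); split.
  by apply: finite_preimage => // x y _ _; exact: f_inj.
apply/seteqP; split=> x /=.
  move=> Px; have gx : semigroup_gen S (f x).
    by have : (P `&` range f) (f x) by []; rewrite PS.
  suff: forall g, semigroup_gen S g ->
      exists2 y, semigroup_gen (f @^-1` S) y & f y = g.
    by move=> /(_ _ gx)[y Sy /f_inj <-].
  apply: semigroup_gen_ind => [h Sh|h k Sh _ [z Sz <-]].
    have [y _ yh] := Sf _ Sh.
    by exists y => //; apply: semigroup_gen_mem; rewrite /= yh.
  have [y _ yh] := Sf _ Sh; exists (y * z); last by rewrite fM yh.
  by apply: semigroup_genM => //; apply: semigroup_gen_mem; rewrite /= yh.
have gf : forall g, semigroup_gen (f @^-1` S) g -> semigroup_gen S (f g).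
  apply: semigroup_gen_ind => [y Sy|y z Sy _ Sz].
    exact: semigroup_gen_mem.
  by rewrite fM; apply: semigroup_genM => //; apply: semigroup_gen_mem.
by move=> /gf; rewrite -PS => -[].
Qed.

End Pullback.

(** * The semigroup generated by a and b when b a^m b = a *)

Section ConeOfTwoGenerators.
Variables (G : groupType) (a b : G) (m : nat).
Hypotheses (m_gt0 : (0 < m)%N) (rel : b * a ^+ m * b = a).

Definition cone2 : set G := semigroup_gen [set a; b].

Lemma cone2a : cone2 a. Proof. by apply: semigroup_gen_mem; left. Qed.
Lemma cone2b : cone2 b. Proof. by apply: semigroup_gen_mem; right. Qed.

#[local] Hint Resolve cone2a cone2b : core.

Lemma cone2M x y : cone2 x -> cone2 y -> cone2 (x * y).
Proof. exact: semigroup_genM. Qed.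

Definition monoid2 x := x = 1 \/ cone2 x.

Lemma monoid2M x y : monoid2 x -> monoid2 y -> monoid2 (x * y).
Proof.
move=> [->|Px] [->|Py]; rewrite ?(mul1g, mulg1); [by left|by right..|].
by right; apply: cone2M.
Qed.

Lemma monoid2X x k : monoid2 x -> monoid2 (x ^+ k).
Proof.
move=> Px; elim: k => [|k IHk]; first by left.
by rewrite expgS; apply: monoid2M.
Qed.

Lemma cone2Ml x y : cone2 x -> monoid2 y -> cone2 (x * y).
Proof. by move=> Px [->|Py]; rewrite ?mulg1 //; apply: cone2M. Qed.

Lemma cone2Mr x y : monoid2 x -> cone2 y -> cone2 (x * y).
Proof. by move=> [->|Px] Py; rewrite ?mul1g //; apply: cone2M. Qed.

Lemma monoid2_ind (K : G -> Prop) : K 1 ->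
    (forall y, monoid2 y -> K y -> K (a * y)) ->
    (forall y, monoid2 y -> K y -> K (b * y)) ->
  forall y, monoid2 y -> K y.
Proof.
move=> K1 Ka Kb y [->//|]; move: y; apply: semigroup_gen_ind => [x|x y].
  by case=> ->; rewrite -[X in K X]mulg1; [apply: Ka|apply: Kb] => //; left.
by case=> -> Py; [apply: Ka|apply: Kb] => //; right.
Qed.

Lemma monoid2a k : monoid2 (a ^+ k). Proof. by apply: monoid2X; right. Qed.
Lemma monoid2b k : monoid2 (b ^+ k). Proof. by apply: monoid2X; right. Qed.

#[local] Hint Resolve monoid2a monoid2b : core.

Lemma mulVba : b^-1 * a = a ^+ m * b.
Proof. by rewrite -[X in _ * X = _]rel -mulgA mulKg. Qed.

Lemma mulaVb : a * b^-1 = b * a ^+ m.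
Proof. by rewrite -[X in X * _]rel mulgK. Qed.

Lemma invbE : b^-1 = a^-1 * b * a ^+ m.
Proof. by rewrite -mulgA -mulaVb mulKg. Qed.

Local Notation D := (a ^+ m.+1).

Let comm_Da : commute D a.
Proof. by apply/commute_sym/commuteX. Qed.

Let comm_Db : commute D b.
Proof.
by rewrite /commute {1}expgS -mulgA -mulVba mulgA mulaVb -mulgA -expgSr.
Qed.

(** The product a^e0 b a^e1 b ... b, which ends with b unless it is empty.  The
    last exponent of a is kept outside so that it can be any integer. *)
Fixpoint nword (es : seq nat) : G :=
  if es is e :: es' then a ^+ e * b * nword es' else 1.

(** The first exponent may be m because a leading a^m b admits no rewriting;
    later in the word, b a^m b would reduce to a. *)
Definition normal (es : seq nat) :=
  (head 0%N es <= m)%N && all (fun e => e < m)%N (behead es).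

Lemma nword_comm es : commute D (nword es).
Proof.
elim: es => [|e es IHes] /=; first exact: commute1.
by apply: commuteM => //; apply: commuteM => //; apply: commuteX.
Qed.

(** If the first exponent passes m, it drops to 0 and the central a^(m+1)
    comes out on the right. *)
Lemma nword_mula es : normal es -> exists es' j,
  [/\ normal es', es' <> [::] \/ (0 < j)%N & a * nword es = nword es' * a ^+ j].
Proof.
case: es => [|e es] /andP[/= em esm].
  by exists [::], 1%N; split=> //; [right|rewrite mul1g mulg1].
case: (ltngtP e m) em => // [em|->] _.
  exists (e.+1 :: es), 0%N; split; [by rewrite /normal /= em|by left|].
  by rewrite mulg1 /= expgS !mulgA.
exists (0%N :: es), m.+1; split; [by []|by left|].
rewrite /= expg0 mul1g -(mulgA (a ^+ m)) [LHS]mulgA -expgS.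
exact: commuteM comm_Db (nword_comm es).
Qed.

(** A word that starts with a^m b is the only delicate case: as b a^m b = a, its
    product by b is a times its tail, whose first exponent is < m. *)
Lemma nword_mulb es : normal es -> exists es' j,
  [/\ normal es', es' <> [::] \/ (0 < j)%N & b * nword es = nword es' * a ^+ j].
Proof.
case: es => [|e es] /andP[/= em esm].
  exists [:: 0%N], 0%N; split; [by [] | by left |].
  by rewrite /= expg0 mul1g !mulg1.
case: (ltngtP e m) em => // [em|->] _.
  exists [:: 0%N, e & es], 0%N; split; [by rewrite /normal /= em|by left|].
  by rewrite mulg1 /= expg0 mul1g.
rewrite /= !mulgA rel; apply: nword_mula; rewrite /normal.
by case: es esm => //= e' es /andP[/ltnW-> ->].
Qed.

Lemma cone2_nword x : cone2 x -> exists es j,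
  [/\ normal es, es <> [::] \/ (0 < j)%N & x = nword es * a ^+ j].
Proof.
move: x; apply: semigroup_gen_ind => [x|x y abx _ [es [j [es_ok _ ->]]]].
  by case=> ->; [exists [::], 1%N | exists [:: 0%N], 0%N];
    split=> //; [right|rewrite mul1g|left|rewrite /= mul1g !mulg1].
have [es' [k [ok' nz xE]]] : exists es' k,
    [/\ normal es', es' <> [::] \/ (0 < k)%N &
        x * nword es = nword es' * a ^+ k].
  by case: abx => ->; [apply: nword_mula|apply: nword_mulb].
exists es', (k + j)%N; split=> //; last by rewrite mulgA xE -mulgA expgnDr.
by case: nz => [|k0]; [left|right; rewrite addn_gt0 k0].
Qed.

(** In the inverse word each b^-1 becomes a^-1 b a^m.  Between two b's the
    exponent of a is then m - e - 1 for some e < m; after the last b it is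
    m - e0, where e0 <= m; and a^d makes up for the initial a^-1. *)
Lemma nword_inv_cone2 es d : normal es -> (0 < d)%N ->
  cone2 (a ^+ d * (nword es)^-1).
Proof.
move=> + d_gt0; have [k] := ubnP (size es); elim: k es => // k IHk [|e es].
  case: d d_gt0 {IHk} => // d _ _ _.
  by rewrite /= invg1 mulg1 expgS; apply: cone2Ml.
rewrite ltnS => szk /andP[/= em esm].
rewrite !invgM invbE -!mulgA -expgnFr //.
rewrite !mulgA; apply: cone2Ml => //; apply: cone2Mr => //.
case: es szk esm => [_ _|e' es szk /andP[e'm esm]].
  by case: d d_gt0 {IHk} => // d _; rewrite /= invg1 mulg1 expgSr mulgK.
(* The pending a^-1 raises the next exponent by one; it stays at most m. *)
right; have -> : a ^+ d * (nword (e' :: es))^-1 * a^-1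
    = a ^+ d * (nword (e'.+1 :: es))^-1.
  by rewrite -mulgA -invgM /= expgS !mulgA.
by apply: IHk => //; rewrite /normal /= e'm.
Qed.

Hypothesis nword_free : forall es j,
  normal es -> nword es * a ^+ j = 1 -> es = [::] /\ j = 0%N.

Lemma cone2_neq1 : ~ cone2 1.
Proof.
move=> /cone2_nword[es [j [ok nz /esym/(nword_free ok)[es0 j0]]]].
by case: nz; rewrite ?es0 ?j0.
Qed.

(** Since a^(m+1) is a positive central element, the elements that become
    positive after multiplication by one of its powers form a set closed under
    left multiplication by a, b and a^-1.  The relation expresses b^-1 by these,
    so the set is everything as soon as a and b generate. *)
Definition has_positive_multiple x := exists q, monoid2 (x * a ^+ m.+1 ^+ q).

Lemma positive_multipleM x y :
  monoid2 x -> has_positive_multiple y -> has_positive_multiple (x * y).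
Proof. by move=> Px [q Py]; exists q; rewrite -mulgA; apply: monoid2M. Qed.

Lemma positive_multiple_mulVa y : commute (a ^+ m.+1) y ->
  has_positive_multiple y -> has_positive_multiple (a^-1 * y).
Proof.
move=> Dy [q Py]; exists q.+1.
rewrite expgS -mulgA [y * _]mulgA -Dy expgS -!mulgA mulKg -expgS.
by apply: monoid2M.
Qed.

Hypothesis gen : forall x, has_positive_multiple x.

Lemma cone2_total x : [\/ cone2 x, cone2 x^-1 | x = 1].
Proof.
have [q Pxq] := gen x.
have [es [j [ok xE]]] : exists es j,
    normal es /\ x * D ^+ q = nword es * a ^+ j.
  case: Pxq => [->|/cone2_nword[es [j [ok _ ->]]]]; last by exists es, j.
  by exists [::], 0%N; rewrite mul1g.
(* The total last exponent is j - (m + 1) q; its sign decides that of x. *)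
have {xE} : x = nword es * a ^+ j * a ^- (m.+1 * q).
  by rewrite -xE expgnA mulgK.
case: (leqP (m.+1 * q) j) => jq xE.
  have nword_pos es' : monoid2 (nword es').
    by elim: es' => [|e es' IH] /=; [left|do !apply: monoid2M => //; right].
  have : monoid2 x by rewrite xE -mulgA -expgnFr //; apply: monoid2M.
  by case=> Px; [apply: Or33 | apply: Or31].
apply: Or32; rewrite xE -mulgA -invgF -expgnFr ?(ltnW jq) // invgF.
by apply: nword_inv_cone2; rewrite ?subn_gt0.
Qed.

(** * The part of the semigroup in a subgroup of finite index *)

Section FiniteIndex.
Variables (H : set G) (N : nat).
Hypotheses (N_gt0 : (0 < N)%N) (HM : forall x y, H x -> H y -> H (x * y)).
Hypotheses (HV : forall x, H x -> H x^-1) (HbN : H (b ^+ N)).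
Hypothesis Hcoset : forall x, exists2 r, (r < N)%N & H (x * b ^- r).

Definition block (i k r : nat) : G := b ^+ i * a * b ^+ k * b ^- r.

Definition cone_gens : set G :=
  H `&` ([set x | exists2 r, (0 < r <= N)%N & x = b ^+ r] `|`
         [set x | exists i k r : 'I_N.+1, x = block i k r]).

Lemma cone_gens_finite : finite_set cone_gens.
Proof.
pose f (t : 'I_N.+1 + 'I_N.+1 * 'I_N.+1 * 'I_N.+1) : G :=
  match t with inl r => b ^+ r | inr (i, k, r) => block i k r end.
apply: (sub_finite_set (B := range f)); last first.
  by apply: finite_image; apply: finite_finset.
move=> x [_ [[r /andP[_ rN] ->]|[i [k [r ->]]]]]; last first.
  by exists (inr (i, k, r)).
by exists (inl (inord r)); rewrite //= inordK.
Qed.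

(** Moving b^-1 to the left across a turns it into the positive b a^(m-1), and
    an a remains at the end for the next b^-1. *)
Lemma mulabV_cone2 r : cone2 (a * b ^- r).
Proof.
suff [y Py ->] : exists2 y, monoid2 y & a * b ^- r = y * a.
  by apply: cone2Mr.
elim: r => [|r [y Py IHr]].
  by exists 1; [left|rewrite expg0 invg1 mulg1 mul1g].
exists (y * b * a ^+ m.-1).
  by do !apply: monoid2M => //; right.
by rewrite expgS invgM mulgA IHr -!mulgA mulaVb -expgSr prednK.
Qed.

Lemma block_cone2 i k r : cone2 (block i k r).
Proof.
rewrite /block -2!mulgA; apply: cone2Mr => //.
case: (leqP r k) => [rk|/ltnW kr]; first by rewrite -expgnFr //; apply: cone2Ml.
by rewrite -invgF -expgnFr //; apply: mulabV_cone2.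
Qed.

Let Q := semigroup_gen cone_gens.

Let HMl x y : H x -> H (x * y) -> H y.
Proof. by move=> Hx Hxy; rewrite -(mulKg x y); apply: HM => //; apply: HV. Qed.

Let HMr x y : H y -> H (x * y) -> H x.
Proof. by move=> Hy Hxy; rewrite -(mulgK y x); apply: HM => //; apply: HV. Qed.

Let HbNX q : H (b ^+ (N * q)).
Proof.
rewrite expgnA; elim: q => [|q IHq]; last by rewrite expgS; apply: HM.
by rewrite expg0 -(mulgV (b ^+ N)); apply: HM => //; apply: HV.
Qed.

Let HbN_gen : cone_gens (b ^+ N).
Proof. by split=> //; left; exists N; rewrite ?N_gt0 ?leqnn. Qed.

Let Q_mulbN x q : Q x -> Q (x * b ^+ (N * q)).
Proof.
move=> Qx; rewrite expgnA; elim: q => [|q IHq]; first by rewrite mulg1.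
by rewrite expgSr mulgA; apply: semigroup_genM => //; apply: semigroup_gen_mem.
Qed.

Let Q_bNmul x q : Q x -> Q (b ^+ (N * q) * x).
Proof.
move=> Qx; rewrite expgnA; elim: q => [|q IHq]; first by rewrite mul1g.
by rewrite expgS -mulgA; apply: semigroup_genM => //; apply: semigroup_gen_mem.
Qed.

Let block_gen i k r : (i < N)%N -> (r < N)%N -> H (block i k r) ->
  Q (block i k r).
Proof.
move=> iN rN; have kN : (k %% N < N)%N by rewrite ltn_mod.
have kE : block i k r = block i (k %% N)%N r * b ^+ (N * (k %/ N)%N).
  rewrite /block {1}(divn_eq k N) addnC mulnC expgnDr -!mulgA.
  by do 3!congr (_ * _); apply: commuteV; apply: commuteX2.
rewrite kE => Hb; apply: Q_mulbN; apply: semigroup_gen_mem; split.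
  exact: HMr Hb.
right; exists (inord i), (inord (k %% N)%N), (inord r).
by rewrite !inordK // ltnW.
Qed.

(** The accumulator k is the length of the current run of b's.  When the next a
    arrives, the run is cut by the b^-r that brings the piece read so far into
    H, and the next piece starts with b^r. *)
Let segment_gen y : monoid2 y -> forall i k, (i < N)%N ->
  H (b ^+ i * a * b ^+ k * y) -> Q (b ^+ i * a * b ^+ k * y).
Proof.
move: y; apply: monoid2_ind => [|y _ IHy|y _ IHy] i k iN Hx.
- have xE : b ^+ i * a * b ^+ k * 1 = block i k 0.
    by rewrite /block expg0 invg1.
  by rewrite xE in Hx *; apply: block_gen.
- have [r rN Hr] := Hcoset (b ^+ i * a * b ^+ k).
  have xE : b ^+ i * a * b ^+ k * (a * y)
      = block i k r * (b ^+ r * a * b ^+ 0 * y).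
    by rewrite /block mulg1 -!mulgA mulKg.
  rewrite xE in Hx *; apply: semigroup_genM; first exact: block_gen.
  by apply: IHy => //; apply: HMl Hx.
- by move: Hx; rewrite !mulgA -(mulgA (_ * a) _ b) -expgSr; apply: IHy.
Qed.

(** Up to its first a, the word is a power of b, whose exponent is reduced
    below N by splitting off the generator b^N. *)
Let lead_gen y : monoid2 y -> forall k,
  H (b ^+ k * y) -> b ^+ k * y = 1 \/ Q (b ^+ k * y).
Proof.
move: y; apply: monoid2_ind => [|y Py _|y _ IHy] k Hx.
- rewrite mulg1 in Hx *.
  have [q [r [rN kE]]] : exists q r, (r < N)%N /\ k = (N * q + r)%N.
    by exists (k %/ N)%N, (k %% N)%N; rewrite ltn_mod mulnC -divn_eq.
  case: r => [|r] in rN kE.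
    case: q => [|q] in kE; first by left; rewrite kE muln0.
    right; rewrite kE addn0 mulnS expgnDr; apply: Q_mulbN.
    exact: semigroup_gen_mem.
  right; rewrite kE expgnDr; apply: Q_bNmul; apply: semigroup_gen_mem; split.
    by apply: (HMl (HbNX q)); rewrite -expgnDr -kE.
  by left; exists r.+1 => //; apply: ltnW.
- right; rewrite (divn_eq k N) mulnC expgnDr -mulgA in Hx *.
  apply: Q_bNmul; rewrite mulgA -[b ^+ _ * a]mulg1 -[1 in X in Q X](expg0 b).
  apply: segment_gen => //; first by rewrite ltn_mod.
  by rewrite expg0 mulg1 -mulgA; apply: HMl Hx.
- by move: Hx; rewrite !mulgA -expgSr; apply: IHy.
Qed.

Lemma cone2_meet_gens : ~ cone2 1 -> cone2 `&` H = semigroup_gen cone_gens.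
Proof.
move=> P1; apply/seteqP; split=> x.
  move=> [Px Hx]; have [] := @lead_gen x _ 0%N; rewrite ?expg0 ?mul1g //.
    by right.
  by move=> x1; case: P1; rewrite -x1.
apply: semigroup_gen_sub => [y z [Py Hy] [Pz Hz]|y [Hy]].
  by split; [apply: cone2M|apply: HM].
case=> [[r /andP[r0 _] yE]|[i [k [r yE]]]]; split=> //; rewrite yE.
  by rewrite -(prednK r0) expgS; apply: cone2Ml.
exact: block_cone2.
Qed.

End FiniteIndex.

End ConeOfTwoGenerators.

(** * The semidirect product of a free group by the shift of its letters *)

Section ShiftProduct.
Import GRing.Theory.
Variable p : nat.
Local Notation n := p.+1.
Local Notation N := n.*2.
Local Notation letter := ('I_n * bool)%type.
Local Notation F := (free_group 'I_n).
Implicit Types (x y : letter) (k l : int) (w : seq letter) (u v : F).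

(** The place of a letter in the cyclic order c_0, ..., c_(N-1). *)
Definition enc x : 'Z_N := (x.1 + (~~ x.2) * n)%:R%R.
Definition dec (z : 'Z_N) : letter :=
  if (z < n)%N then (inord z, true) else (inord (z - n), false).

Lemma encK : cancel enc dec.
Proof.
have doubleE : N = (n + n)%N by rewrite addnn.
case=> i c; rewrite /enc /dec; have i_lt := ltn_ord i.
rewrite val_Zp_nat // modn_small; last first.
  by case: c; rewrite /= ?mul0n ?addn0 ?mul1n doubleE ?ltn_add2r // ltn_addr.
case: c; rewrite /= ?mul0n ?addn0 ?mul1n.
  by rewrite i_lt inord_val.
by rewrite ltnNge leq_addl /= addnK inord_val.
Qed.

Lemma decK : cancel dec enc.
Proof.
move=> z; rewrite /enc /dec.
have doubleE : N = (n + n)%N by rewrite addnn.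
have zN : (z < n + n)%N by rewrite -doubleE.
case: ltnP => zn /=; first by rewrite mul0n addn0 inordK // natr_Zp.
by rewrite mul1n inordK ?ltn_subLR // subnK // natr_Zp.
Qed.

Lemma enc_inj : injective enc. Proof. exact: can_inj encK. Qed.

Definition rot k x := dec (enc x + k%:~R)%R.

Lemma enc_rot k x : enc (rot k x) = (enc x + k%:~R)%R.
Proof. exact: decK. Qed.

Lemma rot0 x : rot 0%R x = x.
Proof. by apply: enc_inj; rewrite enc_rot addr0. Qed.

Lemma rotD k l x : rot (k + l)%R x = rot k (rot l x).
Proof. by apply: enc_inj; rewrite !enc_rot [(k + l)%R]addrC intrD addrA. Qed.

(** Opposite places carry inverse letters; so rotations commute with the
    inversion of letters and extend to automorphisms of the free group. *)
Lemma invl_rot x : invl x = rot n%:Z%R x.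
Proof.
apply: enc_inj; rewrite enc_rot /enc /= -pmulrn -natrD.
case: x.2 => /=; first by rewrite mul0n mul1n addn0.
by rewrite mul0n mul1n addn0 -addnA addnn natrD pchar_Zp // addr0.
Qed.

Lemma rot_invl k x : rot k (invl x) = invl (rot k x).
Proof. by rewrite !invl_rot -!rotD addrC. Qed.

Lemma rot_inj k : injective (rot k).
Proof. by apply: can_inj (rot (- k)%R) _ => x; rewrite -rotD addNr rot0. Qed.

Lemma rot_period q x : rot (N%:Z * q)%R x = x.
Proof.
by apply: enc_inj; rewrite enc_rot intrM -pmulrn pchar_Zp // mul0r addr0.
Qed.

Lemma map_rot_reduced k w : reduced w -> reduced (map (rot k) w).
Proof.
rewrite /reduced sorted_map; apply: sub_sorted => x y /=.
by rewrite -rot_invl (inj_eq (@rot_inj k)).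
Qed.

Lemma map_rot_mulw k w1 w2 :
  map (rot k) (mulw w1 w2) = mulw (map (rot k) w1) (map (rot k) w2).
Proof.
elim: w1 => //= x w1 <-; case: (mulw w1 w2) => [//|y w] /=.
by rewrite -rot_invl (inj_eq (@rot_inj k)); case: ifP.
Qed.

Definition shift k u : F :=
  exist _ (map (rot k) (val u)) (map_rot_reduced k (valP u)).

Lemma shift0 u : shift 0%R u = u.
Proof. by apply: val_inj; rewrite /= (eq_map rot0) map_id. Qed.

Lemma shiftD k l u : shift (k + l)%R u = shift k (shift l u).
Proof.
by apply: val_inj; rewrite /= -map_comp; apply: eq_map => x; apply: rotD.
Qed.

Lemma shiftM k : {morph shift k : u v / u * v}.
Proof. by move=> u v; apply: val_inj; apply: map_rot_mulw. Qed.

Lemma shift1 k : shift k 1 = 1.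
Proof. exact: val_inj. Qed.

Lemma shift_period q u : shift (N%:Z * q)%R u = u.
Proof. by apply: val_inj; rewrite /= (eq_map (rot_period q)) map_id. Qed.

Definition shiftprod := (F * int)%type.
HB.instance Definition _ := Choice.on shiftprod.

Implicit Types g h : shiftprod.

Definition sp_one : shiftprod := (1, 0%R).
Definition sp_mul g h : shiftprod := (g.1 * shift g.2 h.1, (g.2 + h.2)%R).
Definition sp_inv g : shiftprod := (shift (- g.2)%R g.1^-1, (- g.2)%R).

Fact sp_mulA : associative sp_mul.
Proof. by move=> g h k; rewrite /sp_mul /= shiftM shiftD mulgA addrA. Qed.
Fact sp_mul1 : left_id sp_one sp_mul.
Proof. by case=> u k; rewrite /sp_mul /= shift0 mul1g add0r. Qed.
Fact sp_mulr1 : right_id sp_one sp_mul.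
Proof. by case=> u k; rewrite /sp_mul /= shift1 mulg1 addr0. Qed.
Fact sp_mulV : left_inverse sp_one sp_inv sp_mul.
Proof. by case=> u k; rewrite /sp_mul /= -shiftM mulVg shift1 addNr. Qed.
Fact sp_mulrV : right_inverse sp_one sp_inv sp_mul.
Proof. by case=> u k; rewrite /sp_mul /= -shiftD addrN shift0 mulgV. Qed.

HB.instance Definition _ :=
  isGroup.Build shiftprod sp_mulA sp_mul1 sp_mulr1 sp_mulV sp_mulrV.

Lemma sp_mulE g h : g * h = sp_mul g h. Proof. by []. Qed.

Let m := N.-1.

Definition c0 : letter := (ord0, true).
Definition sp_a : shiftprod := (1, 1%R).
Definition sp_b : shiftprod := (fg_gen ord0, (1 - n%:Z)%R).
Local Notation a := sp_a.
Local Notation b := sp_b.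

Lemma sp_aX i : a ^+ i = (1, i%:Z%R) :> shiftprod.
Proof.
elim: i => [//|i IHi].
by rewrite expgS IHi sp_mulE /sp_mul /= shift1 mulg1 intS.
Qed.

Lemma sp_bX2 i : (b ^+ i).2 = (i%:Z * (1 - n%:Z))%R.
Proof.
elim: i => [|i IHi]; first by rewrite mul0r.
rewrite expgS sp_mulE /= IHi; lia.
Qed.

Lemma sp_rel : b * a ^+ m * b = a.
Proof.
rewrite sp_aX !sp_mulE /sp_mul /= shift1 mulg1.
have -> : (1 - n%:Z + m%:Z = n%:Z)%R.
  by rewrite /m doubleS -addnn /=; lia.
congr pair; last by lia.
by apply: val_inj; rewrite /= -invl_rot.
Qed.

Lemma sp_period_comm g : commute (a ^+ N) g.
Proof.
rewrite /commute sp_aX !sp_mulE /sp_mul /= shift1 mulg1 mul1g addrC.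
by rewrite -[N%:Z%R]mulr1 shift_period.
Qed.

(** Induction on the free component, by c_i = a^i b a^(n-1) a^-i. *)
Lemma sp_gen g : has_positive_multiple a b m g.
Proof.
have NE : m.+1 = N by [].
have aVM h :
    has_positive_multiple a b m h -> has_positive_multiple a b m (a^-1 * h).
  by apply: positive_multiple_mulVa; rewrite NE; apply: sp_period_comm.
have aXM i h :
    has_positive_multiple a b m h -> has_positive_multiple a b m (a ^- i * h).
  move=> Ph; elim: i => [|i IHi]; first by rewrite expg0 invg1 mul1g.
  by rewrite expgSr invgM -mulgA; apply: aVM.
case: g => -[w]; elim: w => [|x w IHw] rw k.
  have -> : exist _ [::] rw = 1 :> F by apply: val_inj.
  have P1 : has_positive_multiple a b m 1.
    by exists 0%N; left; rewrite mulg1.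
  case: k => k.
    rewrite -sp_aX -[a ^+ k]mulg1; apply: positive_multipleM => //.
    exact: monoid2a.
  have -> : (1, Negz k) = a ^- k.+1 * 1 :> shiftprod.
    by rewrite mulg1 sp_aX; congr pair; exact: val_inj.
  exact: aXM.
have rw' : reduced w by exact: path_sorted rw.
pose i : nat := val (enc x).
have xE : rot i%:Z%R c0 = x.
  by apply: enc_inj; rewrite enc_rot /enc /= add0r -pmulrn natr_Zp.
have -> : (exist _ (x :: w) rw, k) =
    a ^+ i * (b * (a ^+ p * (a ^- i * ((exist _ w rw' : F), k)))) :> shiftprod.
  rewrite !sp_aX !sp_mulE /sp_mul /= invg1 !shift1 !mul1g shiftM -!shiftD.
  have -> : (i%:Z + (1 - n%:Z) + p%:Z - i%:Z = 0)%R by lia.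
  congr pair; last by lia.
  by apply: val_inj; rewrite shift0 /= xE cons_redE.
apply: positive_multipleM; first exact: monoid2a.
apply: positive_multipleM; first by right; exact: cone2b.
apply: positive_multipleM; first exact: monoid2a.
exact/aXM/IHw.
Qed.

(** The letters of successive b's, separated by a^h, are c_i and c_(i+1-n+h);
    they cancel only if h + 1 = 0 modulo N, while h < m.  The head of the word
    is tracked to make the next step possible; the default value of [head]
    makes the second equality hold for the empty word too. *)
Lemma sp_nword_reduced es : all (fun e => e < m)%N (behead es) ->
  let w := val (nword a b es).1 in
  size w = size es /\ head c0 w = rot (head 0%N es)%:Z%R c0.
Proof.
elim: es => [|e es IHes] /= es_m; first by rewrite rot0.
have es_m' : all (fun e => e < m)%N (behead es).
  by case: es es_m {IHes} => //= ? ? /andP[].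
have := IHes es_m'; rewrite sp_aX /=.
case: (nword a b es) => -[[|y w] rw] k /= [szw hw]; first by rewrite -szw.
rewrite -/c0; set h := head 0%N es in hw.
have h_m : (h < m)%N.
  by rewrite /h; case: es es_m szw {IHes es_m' hw h} => //= ? ? /andP[].
have -> : (rot (e%:Z + (1 - n%:Z)) y == invl (rot e%:Z c0))%R = false.
  apply/negP => /eqP; rewrite hw invl_rot -!rotD => /(congr1 enc).
  rewrite !enc_rot => /addrI /eqP; rewrite -subr_eq0 -intrB.
  have -> : (e%:Z + (1 - n%:Z) + h%:Z - (n%:Z + e%:Z) = h.+1%:Z - N%:Z)%R.
    by lia.
  rewrite intrB -!pmulrn pchar_Zp // subr0 => /eqP/(congr1 (@nat_of_ord _)).
  by rewrite val_Zp_nat // modn_small.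
by rewrite /= size_map szw.
Qed.

Lemma sp_nword_free es j :
  normal m es -> nword a b es * a ^+ j = 1 -> es = [::] /\ j = 0%N.
Proof.
move=> /andP[_ /sp_nword_reduced[sz _]].
rewrite sp_aX sp_mulE /sp_mul shift1 mulg1 => -[w1 k0].
rewrite w1 /= in sz; case: es sz w1 k0 => // _ _.
by rewrite add0r => -[].
Qed.

Definition embed (x : (F * Algebra.to_multiplicative int)%type) : shiftprod :=
  (x.1, (N%:Z * (x.2 : int))%R).

Lemma embedM : {morph embed : x y / x * y}.
Proof.
move=> [u k] [v l]; rewrite /embed sp_mulE /sp_mul /= shift_period.
by congr pair; exact: mulrDr.
Qed.

Lemma embed_inj : injective embed.
Proof. by move=> [u k] [v l] [-> /(mulfI _)->]. Qed.

Lemma range_embed g : (N%:Z %| g.2)%Z -> range embed g.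
Proof.
case: g => u k /dvdzP[q /= ->]; exists (u, q) => //.
by rewrite /embed mulrC.
Qed.

Lemma range_embedM g h : range embed g -> range embed h -> range embed (g * h).
Proof. by move=> [x _ <-] [y _ <-]; exists (x * y); rewrite ?embedM. Qed.

Lemma range_embedV g : range embed g -> range embed g^-1.
Proof.
move=> [x _ <-]; exists x^-1 => //; apply: (mulgI (embed x)).
rewrite -embedM !mulgV; congr pair; exact: mulr0.
Qed.

Lemma sp_bX_period : range embed (b ^+ N).
Proof. by apply: range_embed; rewrite sp_bX2 dvdz_mulr. Qed.

(** The last component of b is 1 - n.  Writing n = 2 h, so that N = 4 h, one has
    (1 - n)^2 = 1 + N (h - 1): 1 - n is its own inverse modulo N, hence r is
    (1 - n) times the last component of g. *)
Lemma sp_coset : ~~ odd n -> forall g,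
  exists2 r, (r < N)%N & range embed (g * b ^- r).
Proof.
move=> n_even g; pose s := ((1 - n%:Z) * g.2)%R.
have r_ge0 : (0 <= s %% N)%Z%R by rewrite modz_ge0.
exists `|(s %% N)%Z|%N; first by rewrite -ltz_nat gez0_abs // ltz_pmod.
apply: range_embed; rewrite sp_mulE /= sp_bX2 gez0_abs //.
have nE : n = n./2.*2 by rewrite -[LHS]odd_double_half (negPf n_even).
apply/dvdzP; exists (g.2 * (1 - n./2%:Z) + (s %/ N)%Z * (1 - n%:Z))%R.
have -> : ((s %% N)%Z = s - (s %/ N)%Z * N%:Z)%R by [].
rewrite /s; move: (_ %/ _)%Z => q; move: (n./2) nE => h nE.
have -> : (N%:Z = 4 * h%:Z)%R by lia.
have -> : (n%:Z = 2 * h%:Z)%R by lia.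
ring.
Qed.

End ShiftProduct.

(* [Algebra.to_multiplicative int] is the additive group of the integers, with
   its law written multiplicatively. *)
Theorem theorem1p1 (n : nat) (n_ge2 : (2 <= n)%N) (n_even : ~~ odd n) :
  exists P : set (free_group 'I_n * Algebra.to_multiplicative int)%type,
    positive_cone P /\ fin_gen_semigroup P.
Proof.
case: n n_ge2 n_even => // p _ n_even.
have rel := @sp_rel p; have nword_free := @sp_nword_free p.
have P1 : ~ cone2 (sp_a p) (sp_b p) 1 by apply: cone2_neq1 rel nword_free.
exists (@embed p @^-1` cone2 (sp_a p) (sp_b p)); split.
  apply: positive_cone_preimage => //.
  - exact: embedM.
  - exact: embed_inj.
  - exact: cone2M.
  - exact: cone2_total rel (@sp_gen p).
have finS := cone_gens_finite (sp_a p) (sp_b p) (range (@embed p)) p.+1.*2.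
apply: (fin_gen_preimage (@embedM p) (@embed_inj p) finS).
- by move=> x [].
apply: (cone2_meet_gens _ rel) => //.
- exact: range_embedM.
- exact: range_embedV.
- exact: sp_bX_period.
- exact: sp_coset.
Qed.
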